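(* Let $T=U|T|\in\mathcal{M}_m(\mathbb{C})$ be an invertible and centered $m\times m$ complex matrix, and let $\mathfrak{m}_f$ be an operator mean with representing function $f$ satisfying $f(x)\le 1-\lambda+\lambda x$ for all $x>0$, where $\lambda:=f'(1)\in(0,1)$. Then the sequence $\{\Delta_{\mathfrak{m}_f}^n(T)\}$ converges to a normal matrix as $n\to\infty$.
   Context: $|T|=(T^*T)^{1/2}$; for invertible $T$ the factor $U$ in the polar decomposition $T=U|T|$ is unitary. Operator mean: $\mathfrak{m}_f$ corresponds to a representing function $f:(0,\infty)\to(0,\infty)$, operator monotone with $f(1)=1$; for positive invertible $A,B$, $\mathfrak{m}_f(A,B)=A^{1/2}f(A^{-1/2}BA^{-1/2})A^{1/2}$. Induced Aluthge transformation: for invertible $T=U|T|$ with spectral decomposition $|T|=\int_{\sigma(|T|)}s\,dE_s$, define $\Delta_{\mathfrak{m}_f}(T)=\Delta_f(T):=\int_{\sigma(|T|)}\int_{\sigma(|T|)} s f(t/s)\,dE_s\,U\,dE_t$; for a matrix with $|T|=\sum_i s_iE_i$ ($s_i$ distinct eigenvalues, $E_i$ spectral projections) this is $\Delta_f(T)=\sum_{i,j}s_i f(s_j/s_i)E_iUE_j$. Iterates: $\Delta_f^0(T)=T$, $\Delta_f^n(T)=\Delta_f(\Delta_f^{n-1}(T))$. $T=U|T|$ is centered if $\{U^{*m}|T|U^m,\ |T|,\ U^n|T|U^{*n}: n,m=1,2,\dots\}$ is a commuting set. *)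

(* Defs.v *)
From HB Require Import structures.
From mathcomp Require Import all_boot all_order all_algebra.
From mathcomp Require Import all_classical all_reals all_analysis.
From mathcomp Require Import complex.
Import Order.TTheory GRing.Theory Num.Theory.
Import numFieldNormedType.Exports.

Set Implicit Arguments.
Unset Strict Implicit.
Unset Printing Implicit Defensive.

Local Open Scope classical_set_scope.
Local Open Scope sesquilinear_scope.
Local Open Scope complex_scope.
Local Open Scope ring_scope.

(* R[i] itself carries no topology in the libraries; the generic topology of a
   numFieldType (balls of the modulus) is inferred through this packaging, and
   matrices over it get the entrywise topology. *)
Definition Cplx (R : realType) : numClosedFieldType := R[i].

Section Defs.
Variable R : realType.
Local Notation C := (Cplx R).

(* Continuous functional calculus g(A), meant for Hermitian A: the entries of
   spectral_diag A are then real, so taking their real part loses nothing.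
   By orthomx_spectralP, A = invmx P *m diag_mx sp *m P with P unitary. *)
Definition hfun n (g : R -> R) (A : 'M[C]_n) : 'M[C]_n :=
  let P := spectralmx A in
  invmx P *m diag_mx (map_mx (fun z : C => (g (complex.Re z))%:C : C)
                             (spectral_diag A)) *m P.

(* In C, [0 <= z] means that z is real and nonnegative. *)
Definition psdmx n (A : 'M[C]_n) : Prop :=
  A \is hermsymmx /\ forall v : 'rV[C]_n, 0 <= (v *m A *m v^t* ) 0 0.

Definition loewner_le n (A B : 'M[C]_n) : Prop := psdmx (B - A).

Definition posinvmx n (A : 'M[C]_n) : Prop := psdmx A /\ A \in unitmx.

(* Monotonicity on positive invertible matrices of every order. *)
Definition operator_monotone (f : R -> R) : Prop :=
  forall n (A B : 'M[C]_n), posinvmx A -> posinvmx B ->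
    loewner_le A B -> loewner_le (hfun f A) (hfun f B).

(* Representing functions of operator means; a function (0,oo) -> (0,oo) is
   encoded as f : R -> R whose values outside (0,oo) are irrelevant. *)
Definition representing_function (f : R -> R) : Prop :=
  [/\ forall x, 0 < x -> 0 < f x, operator_monotone f & f 1 = 1].

Section Matrix.
Variable m : nat.
Implicit Types T A : 'M[C]_m.

Definition absmx T : 'M[C]_m := hfun Num.sqrt (T^t* *m T).

(* The factor U of T = U|T|, for invertible T. *)
Definition polar_unitary T : 'M[C]_m := T *m invmx (absmx T).

(* For Hermitian A: undup makes the listed eigenvalues distinct, and the
   spectral projection at s is the indicator function of {s} applied to A. *)
Definition eigenvalues A : seq R :=
  undup [seq complex.Re (spectral_diag A 0 i) | i <- enum 'I_m].

Definition spectral_proj A (s : R) : 'M[C]_m :=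
  hfun (fun x => (x == s)%:R) A.

Definition aluthge (f : R -> R) T : 'M[C]_m :=
  let E := spectral_proj (absmx T) in
  \sum_(s <- eigenvalues (absmx T)) \sum_(t <- eigenvalues (absmx T))
    ((s * f (t / s))%:C : C) *: (E s *m polar_unitary T *m E t).

Definition centered_family T : set 'M[C]_m :=
  let U := polar_unitary T in
  [set X | [\/ exists2 k : nat, (0 < k)%N &
                 X = (U^t* ) ^+ k *m absmx T *m U ^+ k,
               X = absmx T
             | exists2 k : nat, (0 < k)%N &
                 X = U ^+ k *m absmx T *m (U^t* ) ^+ k]].

Definition centered T : Prop :=
  forall X Y, centered_family T X -> centered_family T Y ->
    X *m Y = Y *m X.

End Matrix.
End Defs.

(* Main.v *)
Require Import Defs.
From mathcomp Require Import all_boot all_order all_algebra.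
From mathcomp Require Import all_classical all_reals all_analysis.
From mathcomp Require Import complex.
From mathcomp Require Import ring lra.
Import Order.TTheory GRing.Theory Num.Theory.
Import numFieldNormedType.Exports.

(** Write [T = U P] with [U] unitary and [P = |T|].  Since [T] is centered,
    [P] commutes with [U^* P U], so the transform of [T] is [U Q] with
    [Q = m_f (U^* P U, P)], the function [s f(t/s)] of this commuting pair
    ([jointfunE]).  The matrix [Q] is positive and invertible, and it still
    commutes with all its rotations [U^{*k} Q U^k], because [Q] commutes with
    everything that commutes with both [P] and [U^* P U]
    ([comm_orbit_bicommutant]).  The unitary factor [U] is therefore the same
    along the whole iteration, and only the positive factors [P_k] move.

    The bound on [f] says that
    [P_{k+1} <= M(P_k) := lambda P_k + (1 - lambda) U^* P_k U] in the Loewner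
    order ([aluthge_step]).  In an orthonormal eigenbasis of [U], with
    eigenvalues [d_i], the map [M] multiplies the entry [(i, j)] by
    [c_ij = lambda + (1 - lambda) conj(d_i) d_j], a number that is 1 when
    [d_i = d_j] and has modulus less than 1 otherwise.  The positive
    semidefinite gaps [E_k = M(P_k) - P_{k+1}] telescope on the diagonal, where
    [c_ii = 1], so their diagonal entries are summable; an entry of a positive
    semidefinite matrix is bounded by the sum of the two diagonal entries in
    its row and column ([psd_entry_bound]), so all entries of the gaps are
    summable.  Every entry of [P_k] thus follows a scalar recursion
    [y_{k+1} = c y_k - e_k] with summable [e_k], and converges, to 0 when
    [c != 1] ([scalar_recursion_cvg]).  The limit [L] of [P_k] is Hermitian and
    commutes with [U] ([dominated_rotation_cvg]), which makes [U L], the limit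
    of the iterates, normal. *)

Local Open Scope classical_set_scope.
Local Open Scope ring_scope.

Set Implicit Arguments.
Unset Strict Implicit.
Unset Printing Implicit Defensive.

(** * Adjoints and positive semidefinite matrices *)

Section AdjointMatrices.
Local Open Scope sesquilinear_scope.
Variable C : numClosedFieldType.

Lemma adjmxM m n p (A : 'M[C]_(m, n)) (B : 'M[C]_(n, p)) :
  (A *m B)^t* = B^t* *m A^t*.
Proof. by rewrite trmx_mul map_mxM. Qed.

Lemma adjmxZ_real m n (x : C) (A : 'M[C]_(m, n)) :
  x \is Num.real -> (x *: A)^t* = x *: A^t*.
Proof.
by move=> /CrealP xr; apply/matrixP => i j; rewrite !mxE rmorphM /= xr.
Qed.

Lemma hermsymmxP n (A : 'M[C]_n) : reflect (A^t* = A) (A \is hermsymmx).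
Proof. by rewrite is_hermitianmxE expr0 scale1r eq_sym; exact: eqP. Qed.

Lemma adjmx_sum I (r : seq I) m n (F : I -> 'M[C]_(m, n)) :
  (\sum_(i <- r) F i)^t* = \sum_(i <- r) (F i)^t*.
Proof. by rewrite raddf_sum map_mx_sum. Qed.

Lemma unitarymxKl n (U : 'M[C]_n) : U \is unitarymx -> U^t* *m U = 1%:M.
Proof. by move/unitarymxP/mulmx1C. Qed.

(** Positive semidefiniteness over an arbitrary algebraically closed numeric
    field; over the complex numbers it unfolds to [psdmx]. *)
Definition psd n (A : 'M[C]_n) : Prop :=
  A \is hermsymmx /\ forall v : 'rV[C]_n, 0 <= (v *m A *m v^t*) 0 0.

Lemma dot_ge0 n (u : 'rV[C]_n) : 0 <= (u *m u^t*) 0 0.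
Proof.
by rewrite mxE; apply: sumr_ge0 => i _; rewrite !mxE mul_conjC_ge0.
Qed.

Lemma psd_gram n k (S : 'M[C]_(n, k)) : psd (S *m S^t*).
Proof.
split; first by apply/hermsymmxP; rewrite adjmxM trmxCK.
move=> v; rewrite mulmxA -[_ *m S^t* *m _]mulmxA -adjmxM; exact: dot_ge0.
Qed.

Lemma psd_congr n (A S : 'M[C]_n) : psd A -> psd (S *m A *m S^t*).
Proof.
case=> /hermsymmxP hA pA; split.
  by apply/hermsymmxP; rewrite !adjmxM trmxCK hA mulmxA.
by move=> v; have := pA (v *m S); rewrite adjmxM !mulmxA.
Qed.

(** An intertwiner of two diagonal matrices has a zero entry wherever the
    diagonal values differ, so it intertwines any function of them. *)
Lemma diag_mx_intertwine n (phi : C -> C) (d e : 'rV[C]_n) (S : 'M[C]_n) :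
  diag_mx d *m S = S *m diag_mx e ->
  diag_mx (map_mx phi d) *m S = S *m diag_mx (map_mx phi e).
Proof.
move=> eqS; apply/matrixP => i j; move/matrixP/(_ i j): eqS.
rewrite !mul_diag_mx !mul_mx_diag !mxE [S i j * _]mulrC => /eqP.
rewrite -subr_eq0 -mulrBl mulf_eq0.
case/orP=> [|/eqP ->]; last by rewrite mulr0 mul0r.
by rewrite subr_eq0 => /eqP ->; rewrite mulrC.
Qed.

End AdjointMatrices.

(** * Functional calculus of normal matrices *)

Section NormalCalculus.
Local Open Scope sesquilinear_scope.
Variables (C : numClosedFieldType) (n : nat).
Implicit Types (A B X U V W : 'M[C]_n) (g h : C -> C).

(** The functional calculus of a normal matrix, through its unitary
    diagonalization. *)
Definition mxfun g A : 'M[C]_n :=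
  invmx (spectralmx A) *m diag_mx (map_mx g (spectral_diag A)) *m spectralmx A.

Lemma spectral_eq A : A \is normalmx ->
  spectralmx A *m A = diag_mx (spectral_diag A) *m spectralmx A.
Proof.
move/orthomx_spectralP => {2}->.
by rewrite !mulmxA mulmxV ?spectral_unit // mul1mx.
Qed.

(** Applied with [A = B] this gives commutation with [mxfun g A]; applied with a
    unitary [X], independence of the chosen diagonalization. *)
Lemma mxfun_intertwine g A B X : A \is normalmx -> B \is normalmx ->
  A *m X = X *m B -> mxfun g A *m X = X *m mxfun g B.
Proof.
move=> nA nB eqX; rewrite /mxfun.
have eA := spectral_eq nA; have eB := spectral_eq nB.
have uW := spectral_unit A; have uV := spectral_unit B.
move: (spectralmx A) (spectralmx B) uW uV eA eB => W V uW uV eA eB.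
pose S := W *m X *m invmx V.
have : diag_mx (spectral_diag A) *m S = S *m diag_mx (spectral_diag B).
  apply: (can_inj (mulmxK uV)).
  rewrite /S !mulmxA mulmxKV // -eA -[W *m A *m X]mulmxA eqX.
  by rewrite -!mulmxA -eB (mulKmx uV).
move/(diag_mx_intertwine g).
set dA := diag_mx _; set dB := diag_mx _ => eqS.
have -> : invmx W *m dA *m W *m X = invmx W *m (dA *m S) *m V.
  by rewrite /S !mulmxA mulmxKV.
by rewrite eqS /S !mulmxA mulVmx // mul1mx.
Qed.

Lemma mxfun_comm g A X : A \is normalmx ->
  X *m A = A *m X -> X *m mxfun g A = mxfun g A *m X.
Proof. by move=> nA eqX; apply/esym/mxfun_intertwine. Qed.

Lemma normal_diag (d : 'rV[C]_n) : diag_mx d \is normalmx.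
Proof.
apply/normalmxP; rewrite tr_diag_mx map_diag_mx; exact: diag_mxC.
Qed.

Lemma mxfun_diag g (d : 'rV[C]_n) :
  mxfun g (diag_mx d) = diag_mx (map_mx g d).
Proof.
have := spectral_eq (normal_diag d).
move/esym/(diag_mx_intertwine g).
rewrite /mxfun -mulmxA => ->.
by rewrite mulmxA mulVmx ?mul1mx // spectral_unit.
Qed.

Lemma mxfun_normal g A : mxfun g A \is normalmx.
Proof.
apply/orthomx_spectral_subproof.
by eexists (_, _); last by []; exact: spectral_unitarymx.
Qed.

Lemma mxfun_comp g h A : mxfun g (mxfun h A) = mxfun (g \o h) A.
Proof.
have uW := spectral_unit A.
pose D := diag_mx (map_mx h (spectral_diag A)).
have hD : mxfun h A *m invmx (spectralmx A) = invmx (spectralmx A) *m D.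
  by rewrite /mxfun mulmxK.
have := mxfun_intertwine g (mxfun_normal h A) (normal_diag _) hD.
rewrite mxfun_diag => /(canRL (mulmxKV uW)) ->.
by rewrite /mxfun map_mx_comp.
Qed.

Lemma mxfunM g h A : mxfun g A *m mxfun h A = mxfun (fun x => g x * h x) A.
Proof.
rewrite /mxfun !mulmxA mulmxK ?spectral_unit //; congr (_ *m _).
rewrite -mulmxA; congr (_ *m _).
rewrite mulmx_diag; congr diag_mx; apply/matrixP => i j; rewrite !mxE.
by rewrite ord1.
Qed.

Lemma mxfun_adj g A : (mxfun g A)^t* = mxfun (fun x => (g x)^*) A.
Proof.
rewrite /mxfun !adjmxM invmx_unitary ?spectral_unitarymx // trmxCK mulmxA.
by rewrite tr_diag_mx map_diag_mx -map_mx_comp.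
Qed.

Lemma mxfunD g h A : mxfun (fun x => g x + h x) A = mxfun g A + mxfun h A.
Proof.
rewrite /mxfun -mulmxDl -mulmxDr -raddfD; congr (_ *m diag_mx _ *m _).
by apply/matrixP => i j; rewrite !mxE.
Qed.

Lemma mxfunZ (x : C) g A : mxfun (fun y => x * g y) A = x *: mxfun g A.
Proof.
rewrite /mxfun scalemxAl scalemxAr -linearZ /=; congr (_ *m diag_mx _ *m _).
by apply/matrixP => i j; rewrite !mxE.
Qed.

Lemma mxfun_ext g h A :
  (forall i, g (spectral_diag A 0 i) = h (spectral_diag A 0 i)) ->
  mxfun g A = mxfun h A.
Proof.
move=> gh; rewrite /mxfun; congr (_ *m diag_mx _ *m _).
by apply/matrixP => i j; rewrite !mxE ord1 gh.
Qed.

Lemma mxfun1 A : mxfun (fun=> 1) A = 1%:M.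
Proof.
rewrite /mxfun (_ : diag_mx _ = 1%:M) ?mulmx1 ?mulVmx ?spectral_unit //.
by apply/matrixP => i j; rewrite !mxE.
Qed.

Lemma mxfun_id A : A \is normalmx -> mxfun id A = A.
Proof.
by move=> /orthomx_spectralP nA; rewrite [RHS]nA /mxfun map_mx_id.
Qed.

Lemma mxfun_sum I (r : seq I) (c : I -> C) (G : I -> C -> C) A :
  mxfun (fun x => \sum_(s <- r) c s * G s x) A =
  \sum_(s <- r) c s *: mxfun (G s) A.
Proof.
elim: r => [|s r IH].
  rewrite big_nil -[RHS](scale0r (mxfun id A)) -mxfunZ.
  by congr mxfun; apply/funext => x; rewrite big_nil mul0r.
rewrite big_cons -IH -mxfunZ -mxfunD; congr mxfun; apply/funext => x.
by rewrite big_cons.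
Qed.

Lemma row_unitary_dot A i : A \is unitarymx ->
  (row i A *m (row i A)^t*) 0 0 = 1.
Proof.
move/unitarymxP/matrixP/(_ i i); rewrite !mxE eqxx => h.
by rewrite -[RHS]h; apply: eq_bigr => j _; rewrite !mxE.
Qed.

Lemma row_spectral A i : A \is normalmx ->
  row i (spectralmx A) *m A = spectral_diag A 0 i *: row i (spectralmx A).
Proof.
move=> nA; rewrite -row_mul (spectral_eq nA).
by apply/rowP => j; rewrite mul_diag_mx !mxE.
Qed.

Lemma spectral_diag_ge0 A i : psd A -> 0 <= spectral_diag A 0 i.
Proof.
case=> /hermitian_normalmx nA /(_ (row i (spectralmx A))).
rewrite row_spectral // -scalemxAl.
have := row_unitary_dot i (spectral_unitarymx A).
by move: (_ *m _) => M M1; rewrite mxE M1 mulr1.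
Qed.

Lemma spectral_diag_neq0 A i : A \is normalmx -> A \in unitmx ->
  spectral_diag A 0 i != 0.
Proof.
move=> nA uA; apply/eqP => d0; have := row_spectral i nA.
rewrite d0 scale0r => /(canRL (mulmxK uA)); rewrite mul0mx => r0.
have := row_unitary_dot i (spectral_unitarymx A).
by rewrite r0 mul0mx mxE => /eqP; rewrite eq_sym oner_eq0.
Qed.

Lemma spectral_diag_gt0 A i : psd A -> A \in unitmx ->
  0 < spectral_diag A 0 i.
Proof.
move=> pA uA; rewrite lt_def spectral_diag_ge0 // spectral_diag_neq0 //.
by case: pA => /hermitian_normalmx.
Qed.

End NormalCalculus.

(** * Spectral resolutions *)

Section SpectralResolution.
Local Open Scope sesquilinear_scope.
Variables (C : numClosedFieldType) (n : nat).

(** A spectral resolution indexed by [r]: pairwise orthogonal self-adjoint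
    projections summing to the identity. *)
Definition resolution (I : eqType) (r : seq I) (E : I -> 'M[C]_n) : Prop :=
  [/\ uniq r, forall i, (E i)^t* = E i,
      forall i j, E i *m E j = (i == j)%:R *: E i
    & \sum_(i <- r) E i = 1%:M].

(** The function of a resolution that takes the value [c i] on the range of the
    projection [E i]. *)
Definition resfun (I : eqType) (r : seq I) (E : I -> 'M[C]_n) (c : I -> C) :=
  \sum_(i <- r) c i *: E i.

Section Resfun.
Variables (I : eqType) (r : seq I) (E : I -> 'M[C]_n).
Hypothesis resE : resolution r E.
Implicit Types c d : I -> C.

Lemma resfun_proj c i : i \in r -> resfun r E c *m E i = c i *: E i.
Proof.
case: resE => ur _ oE _ ri; rewrite /resfun mulmx_suml (bigD1_seq i) //=.
rewrite -scalemxAl oE eqxx scale1r big1 ?addr0 // => j /negbTE ji.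
by rewrite -scalemxAl oE ji scale0r scaler0.
Qed.

Lemma resfunM c d :
  resfun r E c *m resfun r E d = resfun r E (fun i => c i * d i).
Proof.
rewrite {2}/resfun mulmx_sumr /resfun; apply: eq_big_seq => i ri.
by rewrite -scalemxAr resfun_proj // scalerA mulrC.
Qed.

Lemma resfunB c d :
  resfun r E c - resfun r E d = resfun r E (fun i => c i - d i).
Proof.
by rewrite /resfun -sumrB; apply: eq_bigr => i _; rewrite scalerBl.
Qed.

Lemma eq_resfun c d : {in r, c =1 d} -> resfun r E c = resfun r E d.
Proof. by move=> cd; apply: eq_big_seq => i ri; rewrite cd. Qed.

Lemma resfun1 : resfun r E (fun=> 1) = 1%:M.
Proof.
by case: resE => _ _ _ <-; apply: eq_bigr => i _; rewrite scale1r.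
Qed.

Lemma resfun_adj c : (forall i, c i \is Num.real) ->
  (resfun r E c)^t* = resfun r E c.
Proof.
case: resE => _ hE _ _ cr.
by rewrite /resfun adjmx_sum; apply: eq_bigr => i _; rewrite adjmxZ_real ?hE.
Qed.

(** A nonnegative function of a resolution is the square of its self-adjoint
    square root. *)
Lemma resfun_psd c : {in r, forall i, 0 <= c i} -> psd (resfun r E c).
Proof.
move=> c0; pose s i := if i \in r then sqrtC (c i) else 0.
have -> : resfun r E c = resfun r E s *m (resfun r E s)^t*.
  rewrite resfun_adj; last first.
    move=> i; rewrite /s; case: ifP => // ri.
    by apply: ger0_real; rewrite sqrtC_ge0 c0.
  by rewrite resfunM; apply: eq_resfun => i ri; rewrite /s ri -expr2 sqrtCK.
exact: psd_gram.
Qed.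

Lemma resfun_unit c : {in r, forall i, c i != 0} -> resfun r E c \in unitmx.
Proof.
move=> c0; apply: (proj1 (mulmx1_unit (B := resfun r E (fun i => (c i)^-1)) _)).
by rewrite resfunM -resfun1; apply: eq_resfun => i ri; rewrite divff ?c0.
Qed.

Lemma resfun_comm c X : (forall i, X *m E i = E i *m X) ->
  X *m resfun r E c = resfun r E c *m X.
Proof.
move=> XE; rewrite /resfun mulmx_sumr mulmx_suml; apply: eq_bigr => i _.
by rewrite -scalemxAr -scalemxAl XE.
Qed.

Lemma resolution_conj (U : 'M[C]_n) : U \is unitarymx ->
  resolution r (fun i => U^t* *m E i *m U).
Proof.
case: resE => ur hE oE sE uU; split=> //.
- by move=> i; rewrite !adjmxM trmxCK hE mulmxA.
- move=> i j; rewrite !mulmxA -[_ *m U *m U^t*]mulmxA.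
  rewrite (elimT unitarymxP uU) mulmx1.
  by rewrite -[U^t* *m E i *m E j]mulmxA oE -scalemxAr -scalemxAl.
- by rewrite -mulmx_suml -mulmx_sumr sE mulmx1 unitarymxKl.
Qed.

Lemma resfun_conj (U : 'M[C]_n) c :
  resfun r (fun i => U^t* *m E i *m U) c = U^t* *m resfun r E c *m U.
Proof.
rewrite /resfun mulmx_sumr mulmx_suml; apply: eq_bigr => i _.
by rewrite -scalemxAr -scalemxAl.
Qed.

End Resfun.

(** Commuting resolutions have a common refinement indexed by pairs. *)
Section Product.
Variables (I J : eqType) (r : seq I) (s : seq J).
Variables (E : I -> 'M[C]_n) (F : J -> 'M[C]_n).
Hypotheses (resE : resolution r E) (resF : resolution s F).
Hypothesis EF : forall i j, E i *m F j = F j *m E i.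

Definition prodres (p : I * J) := E p.1 *m F p.2.
Definition prodidx := [seq (i, j) | i <- r, j <- s].

Lemma resolution_prod : resolution prodidx prodres.
Proof.
case: resE resF => ur hE oE sE [us hF oF sF]; split.
- by apply: allpairs_uniq => // -[i j] [i' j'] _ _ [-> ->].
- by move=> p; rewrite /prodres adjmxM hE hF -EF.
- move=> [i j] [i' j']; rewrite /prodres /= !mulmxA -[_ *m F j *m _]mulmxA -EF.
  rewrite !mulmxA oE -[_ *m F j *m _]mulmxA oF -scalemxAr -scalemxAl scalerA.
  by rewrite -natrM mulnb xpair_eqE andbC.
- rewrite big_allpairs_dep /= -[RHS]mulmx1 -{1}sE mulmx_suml -sF.
  by apply: eq_bigr => i _; rewrite mulmx_sumr.
Qed.

Lemma resfun_fst c : resfun prodidx prodres (fun p => c p.1) = resfun r E c.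
Proof.
rewrite /resfun big_allpairs_dep /= -[RHS]mulmx1 mulmx_suml.
case: resF => _ _ _ <-; apply: eq_bigr => i _.
rewrite mulmx_sumr; apply: eq_bigr => j _.
by rewrite -scalemxAl.
Qed.

Lemma resfun_snd c : resfun prodidx prodres (fun p => c p.2) = resfun s F c.
Proof.
rewrite /resfun big_allpairs_dep /= exchange_big -[RHS]mul1mx mulmx_sumr.
case: resE => _ _ _ <-; apply: eq_bigr => j _.
rewrite mulmx_suml; apply: eq_bigr => i _.
by rewrite -scalemxAr.
Qed.

End Product.
End SpectralResolution.

(** * Conjugation by a unitary matrix and commuting orbits *)

Section Rotation.
Local Open Scope sesquilinear_scope.
Variables (C : numClosedFieldType) (n : nat) (U : 'M[C]_n).
Hypothesis uU : U \is unitarymx.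
Implicit Types P Q X Y : 'M[C]_n.

(** The rotation of [X] by [V]: the conjugation [V^* X V], an automorphism in
    [X] when [V] is unitary. *)
Definition rotmx (V X : 'M[C]_n) : 'M[C]_n := V^t* *m X *m V.

Lemma rotmxM X Y : rotmx U (X *m Y) = rotmx U X *m rotmx U Y.
Proof.
rewrite /rotmx !mulmxA -[_ *m U *m U^t*]mulmxA (elimT unitarymxP uU).
by rewrite mulmx1.
Qed.

Lemma gram_unitaryM P : P^t* = P -> (U *m P)^t* *m (U *m P) = P *m P.
Proof.
by move=> hP; rewrite adjmxM hP mulmxA -[_ *m U]mulmxA unitarymxKl ?mulmx1.
Qed.

Lemma rotmxKV : cancel (rotmx (U^t*)) (rotmx U).
Proof.
move=> X; rewrite /rotmx trmxCK !mulmxA unitarymxKl // mul1mx.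
by rewrite -mulmxA unitarymxKl // mulmx1.
Qed.

Lemma rotmxK : cancel (rotmx U) (rotmx (U^t*)).
Proof.
move=> X; rewrite /rotmx trmxCK !mulmxA (elimT unitarymxP uU) mul1mx.
by rewrite -mulmxA (elimT unitarymxP uU) mulmx1.
Qed.

Lemma comm_rotmx X Y : rotmx U X *m rotmx U Y = rotmx U Y *m rotmx U X <->
  X *m Y = Y *m X.
Proof. by rewrite -!rotmxM; split => [/(can_inj rotmxK)|->]. Qed.

Lemma comm_iter_rotmx k X Y :
  iter k (rotmx U) X *m iter k (rotmx U) Y =
  iter k (rotmx U) Y *m iter k (rotmx U) X <->
  X *m Y = Y *m X.
Proof. by elim: k => //= k <-; exact: comm_rotmx. Qed.

Lemma iter_rotmx_surj k X : exists Y, X = iter k (rotmx U) Y.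
Proof.
elim: k X => [|k IH] X; first by exists X.
have [Y eY] := IH (rotmx (U^t*) X); exists Y.
by rewrite iterS -eY rotmxKV.
Qed.

(** [P] commutes with its orbit under the rotation by [U]; when [P = |T|] this
    is what it means for [T = U|T|] to be centered. *)
Definition comm_orbit P :=
  forall k, P *m iter k (rotmx U) P = iter k (rotmx U) P *m P.

Lemma comm_orbit_iter P j k : comm_orbit P ->
  iter j (rotmx U) P *m iter k (rotmx U) P =
  iter k (rotmx U) P *m iter j (rotmx U) P.
Proof.
wlog le_jk : j k / (j <= k)%N => [H cP|cP].
  case: (leqP j k) => [/H|/ltnW/H]; first exact.
  by move=> ->.
by rewrite -(subnKC le_jk) iterD; apply/comm_iter_rotmx/cP.
Qed.

(** The commuting orbit passes from [P] to any [Q] in the bicommutant of [P] and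
    [U^* P U].  Writing [Q] as the [k]-th rotation of some [Y] reduces the
    commutation of [Q] with its [k]-th rotation to that of [Y] with [Q]. *)
Lemma comm_orbit_bicommutant P Q : comm_orbit P ->
    (forall X, X *m P = P *m X -> X *m rotmx U P = rotmx U P *m X ->
      X *m Q = Q *m X) ->
  comm_orbit Q.
Proof.
move=> cP PQ.
have PkQ k : iter k (rotmx U) P *m Q = Q *m iter k (rotmx U) P.
  apply: PQ; first exact: (@comm_orbit_iter P k 0).
  exact: (@comm_orbit_iter P k 1).
move=> k; have [Y eY] := iter_rotmx_surj k Q.
rewrite {1 4}eY; apply/comm_iter_rotmx; apply: PQ.
  by apply/(comm_iter_rotmx k); rewrite -eY PkQ.
by apply/(comm_iter_rotmx k); rewrite -eY -iterSr PkQ.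
Qed.

End Rotation.

(** * Functions of the commuting pair [U^* P U], [P] *)

Section MeanStep.
Local Open Scope sesquilinear_scope.
Variables (C : numClosedFieldType) (n : nat) (U P : 'M[C]_n).
Variables (I : eqType) (r : seq I) (E : I -> 'M[C]_n) (p : I -> C).
Hypotheses (uU : U \is unitarymx) (resE : resolution r E).
Hypothesis PE : P = resfun r E p.
Hypothesis commE : forall i j, rotmx U (E i) *m E j = E j *m rotmx U (E i).
Variable w : I * I -> C.

Let F i := rotmx U (E i).
Let resF : resolution r F. Proof. exact: resolution_conj. Qed.

(** The function of the commuting pair [U^* P U], [P] with values [w (i, j)] on
    the joint eigenspaces. *)
Definition jointfun := resfun (prodidx r r) (prodres F E) w.

(** For [w (s, t) = s f(t/s)] the left-hand side is the double sum that defines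
    the induced Aluthge transform. *)
Lemma jointfunE :
  \sum_(i <- r) \sum_(j <- r) w (i, j) *: (E i *m U *m E j) = U *m jointfun.
Proof.
rewrite /jointfun /resfun big_allpairs_dep /= mulmx_sumr.
apply: eq_bigr => i _; rewrite mulmx_sumr; apply: eq_bigr => j _.
rewrite -scalemxAr; congr (_ *: _).
rewrite /prodres /F /rotmx /= !mulmxA (elimT unitarymxP uU).
by rewrite mul1mx.
Qed.

Lemma jointfun_psd : {in prodidx r r, forall q, 0 <= w q} -> psd jointfun.
Proof. by move=> w0; apply: resfun_psd => //; apply: resolution_prod. Qed.

Lemma jointfun_unit : {in prodidx r r, forall q, w q != 0} ->
  jointfun \in unitmx.
Proof. by move=> w0; apply: resfun_unit => //; apply: resolution_prod. Qed.

(** [jointfun] lies in the bicommutant of the two resolutions. *)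
Lemma jointfun_comm X : (forall i, X *m E i = E i *m X) ->
  (forall i, X *m rotmx U (E i) = rotmx U (E i) *m X) ->
  X *m jointfun = jointfun *m X.
Proof.
move=> XE XF; apply: resfun_comm => -[i j]; rewrite /prodres /=.
by rewrite mulmxA XF -mulmxA XE mulmxA.
Qed.

Lemma jointfun_le (a b : C) :
    {in prodidx r r, forall q, w q <= a * p q.2 + b * p q.1} ->
  psd (a *: P + b *: rotmx U P - jointfun).
Proof.
move=> wle; have resFE := resolution_prod resF resE commE.
have -> : a *: P + b *: rotmx U P =
    resfun (prodidx r r) (prodres F E) (fun q => a * p q.2 + b * p q.1).
  have -> : rotmx U P = resfun r F p by rewrite PE /rotmx -resfun_conj.
  rewrite PE -(resfun_snd r E resF p) -(resfun_fst r F resE p).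
  rewrite /resfun !scaler_sumr -big_split /=; apply: eq_bigr => q _.
  by rewrite !scalerA scalerDl.
rewrite /jointfun resfunB; apply: resfun_psd => // q rq.
by rewrite subr_ge0 wle.
Qed.

End MeanStep.

(** * Polar decomposition and one step of the induced Aluthge transformation *)

Section PolarAluthge.
Local Open Scope sesquilinear_scope.
Local Open Scope complex_scope.
Variables (R : realType) (n : nat).
Local Notation C := (Cplx R).
Implicit Types (A P U T : 'M[C]_n) (f g h : R -> R).

(** The embedding of the reals with codomain [Cplx R], the type of the matrix
    entries. *)
Definition ofreal (x : R) : C := x%:C.

Lemma ofreal_ge0 x : (0 <= ofreal x) = (0 <= x).
Proof. exact: ler0c. Qed.

Lemma ofreal_le x y : (ofreal x <= ofreal y) = (x <= y).
Proof. exact: lecR. Qed.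

Lemma ofreal_real x : ofreal x \is Num.real.
Proof. by apply/complex_realP; exists x. Qed.

Lemma ofrealM x y : ofreal (x * y) = ofreal x * ofreal y.
Proof. exact: rmorphM. Qed.

Lemma ofrealD x y : ofreal (x + y) = ofreal x + ofreal y.
Proof. exact: rmorphD. Qed.

Lemma ofreal_sum I (r : seq I) (F : I -> R) :
  ofreal (\sum_(i <- r) F i) = \sum_(i <- r) ofreal (F i).
Proof. exact: rmorph_sum. Qed.

Lemma ofreal_eq0 x : (ofreal x == 0) = (x == 0).
Proof. by rewrite /ofreal eq_complex /= eqxx andbT. Qed.

Lemma ofreal_Re (z : C) : 0 <= z -> ofreal (complex.Re z) = z.
Proof. by move=> z0; apply: RRe_real; apply: ger0_real. Qed.

Lemma Re_ofreal x : complex.Re (ofreal x) = x.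
Proof. by []. Qed.

Lemma hfunE g A : hfun g A = mxfun (fun z => ofreal (g (complex.Re z))) A.
Proof. by []. Qed.

Lemma eigenvaluesP A i : complex.Re (spectral_diag A 0 i) \in eigenvalues A.
Proof. by rewrite mem_undup; apply/mapP; exists i; rewrite ?mem_enum. Qed.

Lemma hfun_spectral g A :
  hfun g A = resfun (eigenvalues A) (spectral_proj A) (fun s => ofreal (g s)).
Proof.
rewrite /resfun (eq_bigr (fun s => ofreal (g s) *:
  mxfun (fun z => ofreal (complex.Re z == s)%:R) A)) //.
rewrite -mxfun_sum hfunE; apply: mxfun_ext => i.
set x := complex.Re _.
rewrite (bigD1_seq x) ?undup_uniq ?eigenvaluesP //= eqxx mulr1 big1 ?addr0 //.
by move=> s /negbTE; rewrite eq_sym => ->; rewrite mulr0.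
Qed.

Lemma hfun_adj g A : (hfun g A)^t* = hfun g A.
Proof.
rewrite hfunE mxfun_adj; apply: mxfun_ext => i.
by apply/CrealP/ofreal_real.
Qed.

Lemma resolution_spectral A :
  resolution (eigenvalues A) (spectral_proj A).
Proof.
split.
- exact: undup_uniq.
- by move=> s; exact: hfun_adj.
- move=> s t; rewrite /spectral_proj !hfunE mxfunM -mxfunZ.
  apply: mxfun_ext => i; rewrite -ofrealM.
  case: (eqVneq s t) => [->|st].
    by case: eqP; rewrite ?mul1r ?mulr1 ?mulr0.
  rewrite mul0r; case: eqP => [->|_]; last by rewrite mul0r.
  by rewrite (negbTE st) mulr0.
- have := hfun_spectral (fun=> 1) A; rewrite hfunE mxfun1 => ->.
  by apply: eq_bigr => s _; rewrite scale1r.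
Qed.

Lemma eigenvalues_gt0 A s : posinvmx A -> s \in eigenvalues A -> 0 < s.
Proof.
case=> pA uA; rewrite mem_undup => /mapP[i _ ->].
by have := spectral_diag_gt0 i pA uA; rewrite ltcE => /andP[].
Qed.

Lemma hfun_id A : posinvmx A -> hfun id A = A.
Proof.
case=> pA uA; rewrite -[RHS]mxfun_id; last first.
  by apply: hermitian_normalmx; case: pA.
rewrite hfunE; apply: mxfun_ext => i.
by rewrite ofreal_Re // spectral_diag_ge0.
Qed.

Lemma hfun_posinv g A : {in eigenvalues A, forall s, 0 < g s} ->
  posinvmx (hfun g A).
Proof.
move=> g0; rewrite hfun_spectral; split.
  apply: (resfun_psd (resolution_spectral A)) => s sA.
  by rewrite ofreal_ge0 ltW ?g0.
apply: (resfun_unit (resolution_spectral A)) => s sA.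
by rewrite ofreal_eq0 gt_eqF ?g0.
Qed.

(** Uniqueness of the positive polar factor. *)
Lemma absmx_polar U P : U \is unitarymx -> posinvmx P -> absmx (U *m P) = P.
Proof.
move=> uU pP; have hP : P^t* = P by case: pP => -[/hermsymmxP].
have -> : absmx (U *m P) = hfun Num.sqrt (hfun id P *m hfun id P).
  by rewrite /absmx (hfun_id pP) (gram_unitaryM uU hP).
rewrite !hfunE mxfunM mxfun_comp -[RHS](hfun_id pP) hfunE.
apply: mxfun_ext => i; rewrite /comp -ofrealM Re_ofreal -expr2.
rewrite sqrtr_sqr ger0_norm //.
exact/ltW/(eigenvalues_gt0 pP)/eigenvaluesP.
Qed.

Lemma polar_unitaryE U P : U \is unitarymx -> posinvmx P ->
  polar_unitary (U *m P) = U.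
Proof.
by move=> uU pP; rewrite /polar_unitary absmx_polar // mulmxK //; case: pP.
Qed.

Lemma absmx_posinv T : T \in unitmx -> posinvmx (absmx T).
Proof.
move=> uT; apply: hfun_posinv => s sT.
rewrite sqrtr_gt0; apply: eigenvalues_gt0 sT; split.
  by have := psd_gram (T^t*); rewrite trmxCK.
by rewrite unitmx_mul uT andbT map_unitmx unitmx_tr.
Qed.

Lemma absmx_sqr T : T \in unitmx -> absmx T *m absmx T = T^t* *m T.
Proof.
move=> uT; have pT : posinvmx (T^t* *m T).
  split; first by have := psd_gram (T^t*); rewrite trmxCK.
  by rewrite unitmx_mul uT andbT map_unitmx unitmx_tr.
rewrite -[RHS](hfun_id pT) /absmx !hfunE mxfunM; apply: mxfun_ext => i.
rewrite -ofrealM -expr2 sqr_sqrtr //.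
exact/ltW/(eigenvalues_gt0 pT)/eigenvaluesP.
Qed.

Lemma polar_unitary_unitary T : T \in unitmx -> polar_unitary T \is unitarymx.
Proof.
move=> uT; have [[/hermsymmxP hP _] uP] := absmx_posinv uT.
have PP := absmx_sqr uT; rewrite -trmxC_unitary; apply/unitarymxP.
rewrite trmxCK /polar_unitary.
move: (absmx T) hP uP PP => P hP uP PP.
rewrite adjmxM -mulmxA [_ *m (T *m _)]mulmxA -PP -mulmxA mulmxV // mulmx1.
by rewrite -{2}hP -adjmxM mulmxV // trmx1 map_mx1.
Qed.

Lemma polarE T : T \in unitmx -> polar_unitary T *m absmx T = T.
Proof.
by move=> uT; rewrite /polar_unitary mulmxKV //; case: (absmx_posinv uT).
Qed.

Lemma rotmx_iter U X k :
  iter k (rotmx U) X = (U^t*) ^+ k *m X *m U ^+ k.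
Proof.
elim: k => [|k IH]; first by rewrite !expr0 mul1mx mulmx1.
by rewrite iterS IH /rotmx exprS exprSr !mulmxA.
Qed.

Lemma centered_orbit T : centered T ->
  comm_orbit (polar_unitary T) (absmx T).
Proof.
move=> cT [//|k]; rewrite rotmx_iter; apply: cT; first by apply: Or32.
by apply: Or31; exists k.+1.
Qed.

(** One step keeps the unitary factor and the commuting orbit, and the new
    positive factor lies below the corresponding weighted arithmetic mean. *)
Lemma aluthge_step f (lambda : R) U P : U \is unitarymx -> posinvmx P ->
    comm_orbit U P ->
    (forall x, 0 < x -> 0 < f x) ->
    (forall x, 0 < x -> f x <= 1 - lambda + lambda * x) ->
  exists Q, [/\ aluthge f (U *m P) = U *m Q, posinvmx Q, comm_orbit U Q &
    psd (ofreal lambda *: P + ofreal (1 - lambda) *: rotmx U P - Q)].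
Proof.
move=> uU pP cP f0 fle.
have resE := resolution_spectral P.
have nP : P \is normalmx by case: pP => -[/hermitian_normalmx].
have PE : P = resfun (eigenvalues P) (spectral_proj P) ofreal.
  by rewrite -[LHS](hfun_id pP) hfun_spectral.
have commE s t : rotmx U (spectral_proj P s) *m spectral_proj P t =
                 spectral_proj P t *m rotmx U (spectral_proj P s).
  apply: mxfun_comm => //.
  apply/(comm_rotmx (U := U^t*)); first by rewrite trmxC_unitary.
  rewrite rotmxK //; apply/esym/mxfun_comm => //.
  apply/(comm_rotmx uU); rewrite rotmxKV //.
  exact: (cP 1%N).
pose w (q : R * R) : C := ofreal (q.1 * f (q.2 / q.1)).
have wpos q : q \in prodidx (eigenvalues P) (eigenvalues P) ->
    0 < q.1 /\ 0 < q.2.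
  by move=> /allpairsP[[s t] /= [sP tP ->]]; split;
      [exact: eigenvalues_gt0 sP|exact: eigenvalues_gt0 tP].
exists (jointfun U (eigenvalues P) (spectral_proj P) w); split.
- rewrite /aluthge (absmx_polar uU pP) (polar_unitaryE uU pP).
  exact: (jointfunE (eigenvalues P) (spectral_proj P) uU w).
- split.
    apply: (jointfun_psd uU resE commE) => q /wpos[s0 t0].
    by rewrite ofreal_ge0 mulr_ge0 ?ltW // f0 // divr_gt0.
  apply: (jointfun_unit uU resE commE) => q /wpos[s0 t0].
  by rewrite ofreal_eq0 gt_eqF // mulr_gt0 // f0 // divr_gt0.
- apply: (comm_orbit_bicommutant uU cP) => X XP XrP.
  apply: jointfun_comm => s; first exact: mxfun_comm.
  apply: (comm_rotmx (U := U^t*) _ _ _).1; first by rewrite trmxC_unitary.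
  rewrite rotmxK //; apply: mxfun_comm => //.
  by apply/(comm_rotmx uU); rewrite rotmxKV.
- apply: (jointfun_le uU resE PE commE) => q /wpos[s0 t0].
  rewrite -!ofrealM -ofrealD ofreal_le.
  have := fle _ (divr_gt0 t0 s0); rewrite -(ler_pM2l s0) => /le_trans; apply.
  have -> : q.1 * (1 - lambda + lambda * (q.2 / q.1)) =
      lambda * q.2 + (1 - lambda) * q.1 by field; rewrite gt_eqF.
  by [].
Qed.

End PolarAluthge.

(** * Recursions with summable errors *)

Section RealSequences.
Variable R : realType.
Implicit Types (a b e u : nat -> R) (q B : R).

Lemma bounded_nneg_series_cvg u B : (forall k, 0 <= u k) ->
  (forall N, \sum_(0 <= k < N) u k <= B) -> cvgn (series u).
Proof.
move=> u0 uB; apply: nondecreasing_is_cvgn.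
  by move=> j k jk; rewrite -subr_ge0 sub_series_geq // sumr_ge0.
by exists B => _ [N _ <-]; exact: uB.
Qed.

(** A nonnegative sequence contracted up to a summable error tends to 0: its
    partial sums [S_N] satisfy [(1 - q) S_N + u_N <= u_0 + B]. *)
Lemma contraction_cvg0 u e q B : q < 1 ->
    (forall k, 0 <= u k) -> (forall k, u k.+1 <= q * u k + e k) ->
    (forall N, \sum_(0 <= k < N) e k <= B) ->
  u @ \oo --> (0 : R).
Proof.
move=> q1 u0 ule eB; apply: cvg_series_cvg_0.
apply: (@bounded_nneg_series_cvg _ ((u 0%N + B) / (1 - q))) => // N.
have q1' : 0 < 1 - q by rewrite subr_gt0.
rewrite ler_pdivlMr //.
have H : (\sum_(0 <= k < N) u k) * (1 - q) + u N <=
    u 0%N + \sum_(0 <= k < N) e k.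
  elim: N => [|N IH]; first by rewrite !big_nil mul0r addr0 add0r.
  rewrite !big_nat_recr //=; have := ule N; lra.
have := eB N; have := u0 N; lra.
Qed.

Lemma summable_increments_cvg a b B : (forall k, a k.+1 = a k - b k) ->
    (forall N, \sum_(0 <= k < N) `|b k| <= B) ->
  cvgn a.
Proof.
move=> ab bB; have cb : cvgn (series b).
  apply/normed_cvg/(bounded_nneg_series_cvg (B := B)) => [k|//].
  exact: normr_ge0.
have -> : a = (fun k => a 0%N - series b k).
  apply/funext; elim=> [|k IH]; first by rewrite /series /= big_nil subr0.
  by rewrite ab IH /series /= big_nat_recr //= opprD addrA.
apply: is_cvgB => //; exact: is_cvg_cst.
Qed.

End RealSequences.

Section ComplexSequences.
Variable R : realType.
Local Notation C := (Cplx R).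
Implicit Types (y e : nat -> C) (c l z : C) (B : R).

Lemma cvg_ofreal_bound y l (u : nat -> R) :
  (forall k, `|l - y k| <= ofreal (u k)) -> u @ \oo --> (0 : R) ->
  y @ \oo --> l.
Proof.
move=> yu u0; apply/cvgrPdist_lt => eps eps0.
have eE : ofreal (complex.Re eps) = eps by rewrite ofreal_Re // ltW.
have e0 : 0 < complex.Re eps by move: eps0; rewrite ltcE => /andP[].
move/cvgrPdist_lt: u0 => /(_ _ e0); apply: filterS => k /=.
rewrite sub0r normrN => uk; apply: le_lt_trans (yu k) _; rewrite -eE.
by rewrite [X in is_true X]ltcR; apply: le_lt_trans (ler_norm _) uk.
Qed.

Lemma norm_ReIm z :
  `|z| <= ofreal (`|complex.Re z| + `|complex.Im z|).
Proof.
rewrite normc_def [X in is_true X]lecR -[leRHS]ger0_norm ?addr_ge0 //.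
rewrite -(sqrtr_sqr (_ + _)); apply: ler_wsqrtr.
rewrite sqrrD !real_normK ?num_real //.
by rewrite lerD2r lerDl mulrn_wge0 // mulr_ge0.
Qed.

Lemma norm_Re z : `|complex.Re z| <= complex.Re `|z|.
Proof. by rewrite -lecR; have := normc_ge_Re z; rewrite normc_def. Qed.

Lemma norm_Im z : `|complex.Im z| <= complex.Re `|z|.
Proof.
rewrite normc_def /= -sqrtr_sqr; apply: ler_wsqrtr.
by rewrite lerDr sqr_ge0.
Qed.

(** A scalar recursion with summable error converges when its multiplier is 1 or
    has modulus less than 1; in the latter case the limit is 0. *)
Lemma scalar_recursion_cvg y e c B : (`|c| < 1) \/ c = 1 ->
    (forall k, y k.+1 = c * y k - e k) ->
    (forall N, \sum_(0 <= k < N) `|e k| <= ofreal B) ->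
  exists2 l, y @ \oo --> l & c != 1 -> l = 0.
Proof.
move=> hc ye eB.
have nE z : ofreal (complex.Re `|z|) = `|z| by rewrite ofreal_Re.
have eB' N : \sum_(0 <= k < N) complex.Re `|e k| <= B.
  rewrite -(@lecR R) [X in X <= _]ofreal_sum.
  by under eq_bigr do rewrite nE; exact: eB.
case: hc => [c1|c1].
  exists 0 => //.
  apply: (@cvg_ofreal_bound _ _ (fun k => complex.Re `|y k|)) => [k|].
    by rewrite sub0r normrN nE.
  apply: (@contraction_cvg0 _ _ (fun k => complex.Re `|e k|)
    (complex.Re `|c|) B) => //.
  - by move: c1; rewrite ltcE => /andP[].
  - by move=> k; apply: le_trans (norm_Re _).
  - move=> k; rewrite -(@lecR R) -/(ofreal _) -/(ofreal (_ + _)).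
    rewrite ofrealD ofrealM !nE ye -normrM.
    exact: ler_normB.
have [a ca] : exists a : R, (fun k => complex.Re (y k)) @ \oo --> a.
  apply/cvg_ex/(@summable_increments_cvg _ _ (fun k => complex.Re (e k)) B)
    => [k|N].
    by rewrite ye c1 mul1r raddfB.
  by apply: le_trans (eB' N); apply: ler_sum => k _; exact: norm_Re.
have [b cb] : exists b : R, (fun k => complex.Im (y k)) @ \oo --> b.
  apply/cvg_ex/(@summable_increments_cvg _ _ (fun k => complex.Im (e k)) B)
    => [k|N].
    by rewrite ye c1 mul1r raddfB.
  by apply: le_trans (eB' N); apply: ler_sum => k _; exact: norm_Im.
exists (Complex a b : C); last by rewrite c1 eqxx.
apply: (@cvg_ofreal_bound _ _
  (fun k => `|a - complex.Re (y k)| + `|b - complex.Im (y k)|)) => [k|].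
  have := norm_ReIm ((Complex a b : C) - y k).
  by case: (y k).
have -> : (0 : R) = `|a - a| + `|b - b| by rewrite !subrr normr0 addr0.
by apply: cvgD; apply: cvg_norm; apply: cvgB => //; exact: cvg_cst.
Qed.

End ComplexSequences.

(** * Entries of positive semidefinite matrices *)

Section PsdEntries.
Local Open Scope sesquilinear_scope.
Variables (C : numClosedFieldType) (n : nat).
Implicit Types (E : 'M[C]_n) (i j : 'I_n).

Lemma psd_diag_ge0 E i : psd E -> 0 <= E i i.
Proof.
case=> _ /(_ (delta_mx 0 i)); rewrite -rowE trmx_delta map_delta_mx -colE.
by rewrite !mxE.
Qed.

Lemma psd_conj_entry E i j : psd E -> (E i j)^* = E j i.
Proof. by case=> /hermsymmxP hE _; rewrite -{2}hE !mxE. Qed.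

Lemma psd_entry_bound E i j : psd E -> `|E i j| <= E i i + E j j.
Proof.
move=> pE; have Ei := psd_diag_ge0 i pE; have Ej := psd_diag_ge0 j pE.
have [E0|E0] := eqVneq (E i j) 0; first by rewrite E0 normr0 addr_ge0.
have nE0 : `|E i j| != 0 by rewrite normr_eq0.
(* the phase that turns the off-diagonal term into - |E i j| *)
pose a := - ((E i j)^* / `|E i j|).
have aa : a * a^* = 1.
  rewrite /a rmorphN rmorphM /= conjCK fmorphV /= conj_normC.
  rewrite mulrNN mulf_div [_^* * _]mulrC -normCK -expr2 divff //.
  by rewrite expf_neq0.
have aE : a * E i j = - `|E i j|.
  by rewrite /a mulNr mulrAC [_^* * _]mulrC -normCK expr2 mulfK.
case: (pE) => _ /(_ (a *: delta_mx 0 i + delta_mx 0 j)).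
rewrite linearD linearZ /= !trmx_delta map_mxD map_mxZ !map_delta_mx.
rewrite !mulmxDl !mulmxDr -!scalemxAl -!scalemxAr -!rowE.
have rc k l : (row k E *m delta_mx l (0 : 'I_1)) 0 0 = E k l.
  by rewrite -colE !mxE.
have := (rc i i, rc i j, rc j i, rc j j).
move: (row i E *m delta_mx i _) (row i E *m delta_mx j _).
move: (row j E *m delta_mx i _) (row j E *m delta_mx j _) => M1 M2 M3 M4 rcE.
rewrite !mxE !rcE mulrA /= aa mul1r aE -(psd_conj_entry i j pE) -rmorphM /= aE.
rewrite rmorphN /= conj_normC => le0.
have : `|E i j| + `|E i j| <= E i i + E j j.
  rewrite -subr_ge0; apply: le_trans le0 _; rewrite le_eqVlt; apply/orP; left.
  by apply/eqP; ring.
by apply: le_trans; rewrite lerDl.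
Qed.

End PsdEntries.

(** * The rotation in an eigenbasis of the unitary matrix *)

Section UnitaryEigenbasis.
Local Open Scope sesquilinear_scope.
Variables (C : numClosedFieldType) (n : nat) (U : 'M[C]_n).
Hypothesis uU : U \is unitarymx.
Local Notation W := (spectralmx U).
Local Notation d := (spectral_diag U).

Lemma unitary_normal : U \is normalmx.
Proof. by apply/normalmxP; rewrite (elimT unitarymxP uU) unitarymxKl. Qed.

Lemma unitary_spectral_diag i : (d 0 i)^* * d 0 i = 1.
Proof.
have rU := row_spectral i unitary_normal.
have r1 := row_unitary_dot i (spectral_unitarymx U).
have : (row i W *m U) *m (row i W *m U)^t* = row i W *m (row i W)^t*.
  by rewrite adjmxM mulmxA -[_ *m U *m U^t*]mulmxA (elimT unitarymxP uU) mulmx1.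
rewrite rU linearZ /= map_mxZ -scalemxAl -scalemxAr => /matrixP/(_ 0 0).
move: r1; move: (_ *m _) => M M1.
by rewrite !mxE M1 mulr1 mulrC.
Qed.

(** In an eigenbasis of [U] the rotation acts entrywise. *)
Lemma rotmx_eigen_entry X i j :
  (W *m rotmx U X *m W^t*) i j = (d 0 i)^* * d 0 j * (W *m X *m W^t*) i j.
Proof.
have uW := spectral_unitarymx U.
have UW : U *m W^t* = W^t* *m diag_mx d.
  rewrite {1}(orthomx_spectralP unitary_normal) invmx_unitary //.
  by rewrite -[LHS]mulmxA (elimT unitarymxP uW) mulmx1.
have WU : W *m U^t* = (diag_mx d)^t* *m W.
  by rewrite -[in RHS](trmxCK W) -adjmxM -UW adjmxM trmxCK.
have -> : W *m rotmx U X *m W^t* =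
    (diag_mx d)^t* *m (W *m X *m W^t*) *m diag_mx d.
  by rewrite /rotmx !mulmxA WU -2!mulmxA UW !mulmxA.
rewrite tr_diag_mx map_diag_mx mul_mx_diag mxE mul_diag_mx.
by move: (W *m X *m W^t*) => Z; rewrite !mxE mulrAC.
Qed.

(** Entries of the gap between the weighted mean of [X] and its rotation, and
    [Z]. *)
Lemma rotmx_gap_eigen_entry a b X Z i j :
  (W *m (a *: X + b *: rotmx U X - Z) *m W^t*) i j =
  (a + b * ((d 0 i)^* * d 0 j)) * (W *m X *m W^t*) i j - (W *m Z *m W^t*) i j.
Proof.
rewrite mulmxBr mulmxDr -!scalemxAr mulmxBl mulmxDl -!scalemxAl.
have := rotmx_eigen_entry X i j.
move: (W *m X *m _) (W *m Z *m _) (W *m rotmx U X *m _) => M1 M2 M3.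
by rewrite !mxE => ->; ring.
Qed.

(** A matrix that, in an eigenbasis of [U], vanishes between distinct
    eigenvalues commutes with [U]. *)
Lemma eigenblock_comm (Y : 'M[C]_n) :
  (forall i j, (d 0 i)^* * d 0 j != 1 -> Y i j = 0) ->
  U *m (W^t* *m Y *m W) = W^t* *m Y *m W *m U.
Proof.
move=> Y0; have uW := spectral_unitarymx U.
have UE := orthomx_spectralP unitary_normal; rewrite invmx_unitary // in UE.
have DY : diag_mx d *m Y = Y *m diag_mx d.
  rewrite mul_diag_mx mul_mx_diag; apply/matrixP => i j; rewrite !mxE.
  have [dd|/Y0 ->] := eqVneq ((d 0 i)^* * d 0 j) 1; last by rewrite mulr0 mul0r.
  have dd' : d 0 i * (d 0 i)^* = 1 by rewrite mulrC unitary_spectral_diag.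
  by rewrite -[d 0 j]mul1r -dd' -mulrA dd mulr1 mulrC.
clear Y0; move: W (diag_mx d) uW UE DY => V D uV -> DY.
by rewrite !mulmxA !mulmxtVK // -[V^t* *m D *m Y]mulmxA DY !mulmxA.
Qed.

(** The defect from 1 is explicit:
    [|a + (1 - a) z|^2 = 1 - a (1 - a) |1 - z|^2] for unimodular [z]. *)
Lemma convex_unimodular_lt1 (a z : C) : 0 < a -> a < 1 -> z^* * z = 1 ->
  `|a + (1 - a) * z| < 1 \/ a + (1 - a) * z = 1.
Proof.
move=> a0 a1 zz; have [->|z1] := eqVneq z 1; first by right; ring.
left; rewrite -(@ltr_pXn2r _ 2) ?nnegrE // expr1n normCK.
have ar : a^* = a by apply/CrealP/ger0_real/ltW.
have -> : (a + (1 - a) * z) * (a + (1 - a) * z)^* =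
          1 - a * (1 - a) * `|1 - z| ^+ 2.
  rewrite normCK !rmorphD !rmorphM !rmorphB rmorph1 /= ar.
  by rewrite rmorphN /=; move: zz; move: (z^*) => w zz; ring: zz.
have nz : 0 < `|1 - z| by rewrite normr_gt0 subr_eq0 eq_sym.
by rewrite ltrBlDr ltrDl mulr_gt0 ?exprn_gt0 // mulr_gt0 // subr_gt0.
Qed.

End UnitaryEigenbasis.

(** * Entrywise convergence of matrices *)

Section MatrixConvergence.
Local Open Scope sesquilinear_scope.

Lemma cvg_mx (K : numFieldType) m n (X : nat -> 'M[K]_(m, n))
    (L : 'M[K]_(m, n)) :
  (forall i j, (fun k => X k i j) @ \oo --> L i j) -> X @ \oo --> L.
Proof.
move=> cX A [P LP PA]; rewrite /nbhs /=.
have : \forall k \near \oo, forall p : 'I_m * 'I_n, P p.1 p.2 (X k p.1 p.2).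
  by apply: filter_forall => -[i j] /=; exact: (cX i j _ (LP i j)).
by apply: filterS => k Pk; apply: PA => i j; exact: (Pk (i, j)).
Qed.

Lemma cvg_mulmxl (K : numFieldType) m n p (A : 'M[K]_(m, n))
    (X : nat -> 'M[K]_(n, p)) (L : 'M[K]_(n, p)) :
  X @ \oo --> L -> (fun k => A *m X k) @ \oo --> A *m L.
Proof.
move=> cX; apply: cvg_mx => i j.
have -> : (fun k => (A *m X k) i j) = (fun k => \sum_l A i l * X k l j).
  by apply/funext => k; rewrite mxE.
rewrite mxE; apply: (@cvg_big K) => [|l _]; first exact: add_continuous.
apply: cvgMr.
exact: (continuous_cvg _ (@coord_continuous K n p l j L) cX).
Qed.

Lemma cvg_mx_entry (K : numFieldType) m n (X : nat -> 'M[K]_(m, n))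
    (L : 'M[K]_(m, n)) i j :
  X @ \oo --> L -> (fun k => X k i j) @ \oo --> L i j.
Proof.
by move=> cX; exact: (continuous_cvg _ (@coord_continuous K m n i j L) cX).
Qed.

Lemma cvg_mulmxr (K : numFieldType) m n p (X : nat -> 'M[K]_(m, n))
    (A : 'M[K]_(n, p)) (L : 'M[K]_(m, n)) :
  X @ \oo --> L -> (fun k => X k *m A) @ \oo --> L *m A.
Proof.
move=> cX; apply: cvg_mx => i j.
have -> : (fun k => (X k *m A) i j) = (fun k => \sum_l X k i l * A l j).
  by apply/funext => k; rewrite mxE.
rewrite mxE; apply: (@cvg_big K) => [|l _]; first exact: add_continuous.
by apply: cvgMl; exact: cvg_mx_entry.
Qed.

Lemma cvg_adjmx_fixed (K : numClosedFieldType) n (X : nat -> 'M[K]_n)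
    (L : 'M[K]_n) :
  (forall k, (X k)^t* = X k) -> X @ \oo --> L -> L^t* = L.
Proof.
move=> hX cX; apply/matrixP => i j; rewrite !mxE.
suff cij : (fun k => X k i j) @ \oo --> (L j i)^*.
  by apply: (cvg_unique (@norm_hausdorff K K) cij); exact: cvg_mx_entry cX.
have cXji := cvg_mx_entry (i := j) (j := i) cX.
move/cvgrPdist_lt: cXji => cji; apply/cvgrPdist_lt => e e0.
apply: filterS (cji e e0) => k /=.
by rewrite -{2}(hX k) !mxE -rmorphB norm_conjC.
Qed.

End MatrixConvergence.

(** * Convergence of the positive factors and of the iterates *)

Section DominatedIteration.
Local Open Scope sesquilinear_scope.
Variables (R : realType) (n : nat).
Local Notation C := (Cplx R).

(** A sequence of positive semidefinite matrices in which each term lies below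
    a proper convex combination of the previous one and its rotation converges
    to a Hermitian matrix commuting with [U]. *)
Lemma dominated_rotation_cvg (U : 'M[C]_n) (P : nat -> 'M[C]_n) (a : R) :
    U \is unitarymx -> 0 < a -> a < 1 ->
    (forall k, psd (P k)) ->
    (forall k,
      psd (ofreal a *: P k + ofreal (1 - a) *: rotmx U (P k) - P k.+1)) ->
  exists L, [/\ L^t* = L, U *m L = L *m U & P @ \oo --> L].
Proof.
move=> uU a0 a1 pP pE.
pose W := spectralmx U; pose d := spectral_diag U.
have uW : W \is unitarymx by exact: spectral_unitarymx.
(* from here on everything is read in the eigenbasis [W] of [U] *)
pose Y k := W *m P k *m W^t*.
pose E k :=
  W *m (ofreal a *: P k + ofreal (1 - a) *: rotmx U (P k) - P k.+1) *m W^t*.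
have pY k : psd (Y k) by exact: psd_congr.
have {}pE k : psd (E k) by exact: psd_congr.
pose c i j : C := ofreal a + ofreal (1 - a) * ((d 0 i)^* * d 0 j).
have EY k i j : E k i j = c i j * Y k i j - Y k.+1 i j.
  exact: rotmx_gap_eigen_entry.
have YE k i j : Y k.+1 i j = c i j * Y k i j - E k i j.
  by rewrite EY opprB addrCA subrr addr0.
have aE : ofreal (1 - a) = 1 - ofreal a by rewrite /ofreal rmorphB rmorph1.
have ca i j : `|c i j| < 1 \/ c i j = 1.
  rewrite /c aE; apply: convex_unimodular_lt1.
  - by rewrite lt_def ofreal_eq0 ofreal_ge0 gt_eqF // ltW.
  - rewrite -subr_gt0 -aE lt_def ofreal_eq0 ofreal_ge0.
    by rewrite gt_eqF ?subr_ge0 ?subr_gt0 // ltW.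
  - have di := unitary_spectral_diag uU i.
    have dj := unitary_spectral_diag uU j.
    rewrite rmorphM /= conjCK mulrACA [d 0 i * _]mulrC.
    by rewrite -[X in X * _]/((d 0 i)^* * d 0 i) di mul1r.
(* the diagonal entries of the gaps telescope, whence their summability *)
have cii i : c i i = 1.
  by rewrite /c (unitary_spectral_diag uU i) mulr1 aE addrC subrK.
have sE N i : \sum_(0 <= k < N) E k i i <= Y 0%N i i.
  have -> : \sum_(0 <= k < N) E k i i = Y 0%N i i - Y N i i.
    rewrite -opprB -(telescope_sumr (fun k => Y k i i) (leq0n N)) -sumrN.
    apply: eq_bigr => k _.
    by rewrite opprB EY cii mul1r.
  by rewrite gerBl psd_diag_ge0.
have sum_le N i j : \sum_(0 <= k < N) `|E k i j| <= Y 0%N i i + Y 0%N j j.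
  apply: le_trans (lerD (sE N i) (sE N j)); rewrite -big_split /=.
  by apply: ler_sum => k _; exact: psd_entry_bound.
have /choice[l lP] : forall p : 'I_n * 'I_n, exists l : C,
    (fun k => Y k p.1 p.2) @ \oo --> l /\ (c p.1 p.2 != 1 -> l = 0).
  move=> [i j] /=.
  have bnd N : \sum_(0 <= k < N) `|E k i j| <=
      ofreal (complex.Re (Y 0%N i i + Y 0%N j j)).
    by rewrite ofreal_Re ?addr_ge0 ?psd_diag_ge0.
  have [l cl l0] := scalar_recursion_cvg (ca i j) (fun k => YE k i j) bnd.
  by exists l.
pose YL : 'M[C]_n := \matrix_(i, j) l (i, j).
have cY : Y @ \oo --> YL.
  by apply: cvg_mx => i j; rewrite mxE; exact: (lP (i, j)).1.
have PY k : P k = W^t* *m Y k *m W.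
  rewrite /Y !mulmxA unitarymxKl // mul1mx -mulmxA unitarymxKl //.
  by rewrite mulmx1.
have cP : P @ \oo --> W^t* *m YL *m W.
  have -> : P = fun k => W^t* *m Y k *m W by apply/funext.
  by apply: cvg_mulmxr; exact: cvg_mulmxl.
exists (W^t* *m YL *m W); split => //.
- apply: cvg_adjmx_fixed cP => k.
  by have [/hermsymmxP] := pP k.
(* distinct eigenvalues of [U] give a multiplier different from 1 *)
- apply: eigenblock_comm => // i j dd; rewrite mxE; apply: (lP (i, j)).2 => /=.
  apply: contra dd => /eqP; rewrite /c aE => c1.
  move/eqP: c1; rewrite -subr_eq0.
  have -> : ofreal a + (1 - ofreal a) * ((d 0 i)^* * d 0 j) - 1 =
    (1 - ofreal a) * ((d 0 i)^* * d 0 j - 1) by ring.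
  by rewrite mulf_eq0 -aE ofreal_eq0 subr_eq0 (gt_eqF a1) subr_eq0.
Qed.

End DominatedIteration.

Theorem theorem4p1 (R : realType) (m : nat) (T : 'M[Cplx R]_m)
  (f : R -> R) (lambda : R)
  (T_unit : T \in unitmx) (T_centered : centered T)
  (f_repr : representing_function f)
  (f_deriv : is_derive (1 : R) (1 : R) f lambda)
  (lambda_gt0 : 0 < lambda) (lambda_lt1 : lambda < 1)
  (f_le : forall x : R, 0 < x -> f x <= 1 - lambda + lambda * x) :
  exists N : 'M[Cplx R]_m,
    N \is normalmx /\ (fun n : nat => iter n (aluthge f) T) @ \oo --> N.
Proof.
have [f_gt0 _ _] := f_repr.
pose U := polar_unitary T.
have uU : U \is unitarymx by exact: polar_unitary_unitary.
pose good (P : 'M[Cplx R]_m) := posinvmx P /\ comm_orbit U P.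
(* [good P] is the hypothesis under which one step keeps the form [U P] *)
have step (P : 'M[Cplx R]_m) : exists Q, good P ->
    [/\ good Q, aluthge f (U *m P) = U *m Q &
      psd (ofreal lambda *: P + ofreal (1 - lambda) *: rotmx U P - Q)].
  have [[pP cP]|nP] := pselect (good P); last by exists P => /nP.
  by have [Q [aQ pQ cQ leQ]] := aluthge_step uU pP cP f_gt0 f_le; exists Q.
have [g gP] := choice step.
pose P k := iter k g (absmx T).
have goodP k : good (P k).
  elim: k => [|k IH]; last by have [] := gP _ IH.
  by split; [exact: absmx_posinv|exact: centered_orbit].
have aluthgeE k : iter k (aluthge f) T = U *m P k.
  elim: k => [|k IH]; first by rewrite /P /= polarE.
  by rewrite iterS IH; have [] := gP _ (goodP k).
have [L [hL UL cL]] : exists L, [/\ L^t*%sesqui = L, U *m L = L *m U &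
    P @ \oo --> L].
  apply: (dominated_rotation_cvg uU lambda_gt0 lambda_lt1) => k.
    by have [[]] := goodP k.
  by have [] := gP _ (goodP k).
exists (U *m L); split.
  apply/normalmxP; rewrite (gram_unitaryM uU hL) UL adjmxM hL mulmxA.
  by rewrite mulmxtVK.
have -> : (fun k => iter k (aluthge f) T) = (fun k => U *m P k).
  by apply/funext.
exact: cvg_mulmxl.
Qed.
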